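(* Let $\mathcal{H}$ be a real Hilbert space, let $\mathcal{A}:\mathcal{H}\to2^{\mathcal{H}}$ be an operator with $\operatorname{zer}\mathcal{A}\neq\emptyset$, and let $\mathcal{M}$ be an admissible preconditioner for $\mathcal{A}$ with closed range such that $\mathcal{M}^{-1}\mathcal{A}$ is $\mathcal{M}$-monotone. Let $\mathcal{M}=\mathcal{C}\mathcal{C}^*$, where $\mathcal{D}$ is a real Hilbert space and $\mathcal{C}:\mathcal{D}\to\mathcal{H}$ is a bounded linear injective operator with $\mathcal{C}^*$ onto. Let $\mathcal{T}=(\mathcal{M}+\mathcal{A})^{-1}\mathcal{M}$ and $\widetilde{\mathcal{T}}=(I+\mathcal{C}^*\rhd\mathcal{A})^{-1}$. Let $\{\lambda_k\}_{k\in\mathbb{N}}\subset[0,2]$ satisfy $\sum_k\lambda_k(2-\lambda_k)=+\infty$, let $u^0\in\mathcal{H}$ and $u^{k+1}=u^k+\lambda_k(\mathcal{T}u^k-u^k)$ for all $k\in\mathbb{N}$. Then the proximal point algorithm $$w^0=\mathcal{C}^*u^0,\qquad w^{k+1}=w^k+\lambda_k(\widetilde{\mathcal{T}}w^k-w^k)$$ is equivalent to the iteration defining $\{u^k\}_k$, in the sense that $w^k=\mathcal{C}^*u^k$ for all $k\in\mathbb{N}$. Moreover, $\{w^k\}_k$ converges weakly in $\mathcal{D}$ to a point $w^*$ such that $(\mathcal{M}+\mathcal{A})^{-1}\mathcal{C}w^*$ is a fixed point of $\mathcal{T}$.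
   Context: A (possibly multivalued) operator $\mathcal{A}:\mathcal{H}\to2^{\mathcal{H}}$ is identified with its graph in $\mathcal{H}\times\mathcal{H}$; $\operatorname{zer}\mathcal{A}=\{u:0\in\mathcal{A}u\}$; inverses are inverses of multivalued operators (relations). An admissible preconditioner for $\mathcal{A}$ is a linear, bounded, self-adjoint, positive semi-definite operator $\mathcal{M}:\mathcal{H}\to\mathcal{H}$ such that $(\mathcal{M}+\mathcal{A})^{-1}\mathcal{M}$ is single-valued and has full domain. $\mathcal{M}^{-1}\mathcal{A}$ is the multivalued operator with graph $\{(u,z):\mathcal{M}z\in\mathcal{A}u\}$. Put $\langle u,v\rangle_{\mathcal{M}}:=\langle\mathcal{M}u,v\rangle$. An operator $\mathcal{B}$ on $\mathcal{H}$ is $\mathcal{M}$-monotone if $\langle v-v',u-u'\rangle_{\mathcal{M}}\ge0$ for all $(u,v),(u',v')\in\mathcal{B}$. The parallel composition is the multivalued operator on $\mathcal{D}$ given by $\mathcal{C}^*\rhd\mathcal{A}:=(\mathcal{C}^*\mathcal{A}^{-1}\mathcal{C})^{-1}$. Under the hypotheses, $\widetilde{\mathcal{T}}$ is single-valued and everywhere defined on $\mathcal{D}$. *)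

(* Defs.v *)
From HB Require Import structures.
From mathcomp Require Import all_boot all_order all_algebra.
From mathcomp Require Import all_classical all_reals all_analysis.

Set Implicit Arguments.
Unset Strict Implicit.
Unset Printing Implicit Defensive.

Import Order.TTheory GRing.Theory Num.Theory.
Import numFieldNormedType.Exports.

Local Open Scope classical_set_scope.
Local Open Scope ring_scope.

(* A real Hilbert space is a complete normed module whose norm is the one
   induced by a (symmetric, bilinear, positive definite) dot product. *)
HB.mixin Record CompleteNormedModule_isHilbert (R : realType) V
    & CompleteNormedModule R V := {
  inner : {dot V for (@idfun R)} ;
  inner_normE : forall x : V, inner x x = `|x| ^+ 2
}.

#[short(type="hilbertType")]
HB.structure Definition Hilbert (R : realType) :=
  {V of CompleteNormedModule R V & CompleteNormedModule_isHilbert R V}.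

Section BoundedOperators.
Context {R : realType}.

(* [adjoint L u] is the vector representing [x |-> <L x, u>]. For bounded
   linear [L] it exists and is unique by the Riesz theorem; the default value
   [0] is only used when there is no such vector. *)
Definition adjoint {U V : hilbertType R} (L : U -> V) : V -> U :=
  fun v => xget 0 [set u : U | forall x, inner (L x) v = inner x u].

Definition self_adjoint {V : hilbertType R} (L : V -> V) : Prop :=
  adjoint L = L.

Definition positive_semidefinite {V : hilbertType R} (L : V -> V) : Prop :=
  forall x, 0 <= inner (L x) x.

Definition weak_cvg {V : hilbertType R} (w : nat -> V) (l : V) : Prop :=
  forall y, (fun k => inner (w k) y) @ \oo --> inner l y.

End BoundedOperators.

(* A multivalued operator from [X] to [Y] is a map [X -> set Y], that is, its
   graph in curried form. A map [f] is seen as the operator [op_fun f]. *)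
Section MultivaluedOperators.

Definition op_fun {X Y : Type} (f : X -> Y) : X -> set Y :=
  fun x => [set f x].

Definition op_inv {X Y : Type} (A : X -> set Y) : Y -> set X :=
  fun y => [set x | A x y].

Definition op_comp {X Y Z : Type} (B : Y -> set Z) (A : X -> set Y)
    : X -> set Z :=
  fun x => [set z | exists2 y, A x y & B y z].

Definition op_add {X : Type} {Y : zmodType} (A B : X -> set Y) : X -> set Y :=
  fun x => [set a + b | a in A x & b in B x].

Definition zer {X : Type} {Y : zmodType} (A : X -> set Y) : set X :=
  [set x | A x 0].

(* The map underlying a single-valued, everywhere defined operator. *)
Definition op_val {X : Type} {Y : zmodType} (A : X -> set Y) : X -> Y :=
  fun_of_rel (fun=> 0) A.

End MultivaluedOperators.

Section PreconditionedProximalPoint.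
Context {R : realType} {H : hilbertType R}.

(* (M + A)^-1 M *)
Definition precond_resolvent (M : H -> H) (A : H -> set H) : H -> set H :=
  op_comp (op_inv (op_add (op_fun M) A)) (op_fun M).

Definition admissible_preconditioner (A : H -> set H) (M : {linear H -> H})
    : Prop :=
  [/\ bounded_fun_norm M, self_adjoint M, positive_semidefinite M &
      is_totalfun (precond_resolvent M A)].

(* M^-1 A *)
Definition precond_op (M : H -> H) (A : H -> set H) : H -> set H :=
  fun u => [set z | A u (M z)].

Definition inner_by (M : H -> H) (u v : H) : R := inner (M u) v.

Definition monotone_by (M : H -> H) (B : H -> set H) : Prop :=
  forall u v u' v', B u v -> B u' v' -> 0 <= inner_by M (v - v') (u - u').

(* C^* |> A = (C^* A^-1 C)^-1 *)
Definition parallel_comp {D : hilbertType R} (C : D -> H) (A : H -> set H)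
    : D -> set D :=
  op_inv (op_comp (op_fun (adjoint C)) (op_comp (op_inv A) (op_fun C))).

(* (I + C^* |> A)^-1 *)
Definition parallel_resolvent {D : hilbertType R} (C : D -> H)
    (A : H -> set H) : D -> set D :=
  op_inv (op_add (op_fun idfun) (parallel_comp C A)).

End PreconditionedProximalPoint.

(* Main.v *)
Require Import Defs.
From HB Require Import structures.
From mathcomp Require Import all_boot all_order all_algebra.
From mathcomp Require Import all_classical all_reals all_analysis.
From mathcomp Require Import ring lra.

Set Implicit Arguments.
Unset Strict Implicit.
Unset Printing Implicit Defensive.

Import Order.TTheory GRing.Theory Num.Theory.
Import numFieldNormedType.Exports.

Local Open Scope classical_set_scope.
Local Open Scope ring_scope.

(** Write J for the relation (M + A)^-1, T for J M and B for the parallel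
    composition C^* |> A. Unfolding the inverses, z = (I + B)^-1 d means that
    z = C^* y for some y in J (C d). Since C^* is onto, d is some C^* v, and
    then C d = M v, so J (C d) is the single point T v: hence the resolvent of
    B is everywhere defined, single-valued, and intertwined with T by C^*,
    (I + B)^-1 C^* = C^* T. As C^* is linear, it carries the relaxed iteration
    of T to that of (I + B)^-1.

    The points of the graph of B are (C^* y, C^* v) with M v in A y, so the
    M-monotonicity of M^-1 A is exactly the monotonicity of B, once C^* is
    known to be a true adjoint ([inner_adjoint], from the Riesz theorem
    [riesz_representation]). A resolvent of a monotone operator is firmly
    nonexpansive, and C^* maps a zero of A to a fixed point of it. The weak
    convergence of w is therefore the Krasnosel'skii-Mann theorem
    [krasnoselskii_mann]; and if its limit is l = C^* v, then
    J (C l) = {T v} with C^* T v = l, so that M (T v) = M v and T v is a fixed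
    point of T.

    The Krasnosel'skii-Mann theorem rests on Fejer monotonicity (the distance
    to any fixed point decreases, by an amount that makes the residual
    T w_k - w_k tend to 0) and on weak compactness. The latter is used along
    ultrafilters on the indices: all inner products of a bounded family
    converge along an ultrafilter, and the Riesz theorem turns the limits into
    a weak limit ([bounded_ultra_weak_cvg]). Each such weak limit is a fixed
    point ([demiclosed_fixed_point]), and two of them coincide because
    [inner (w n) (l - l')] converges for fixed points l and l' (Opial). A
    sequence with the same limit along all ultrafilters converges
    ([cvg_ultra]). *)

(** * Real inner products *)

Section InnerProduct.
Context {R : realType} {V : hilbertType R}.
Implicit Types (x y z : V) (a : R).

Lemma innerC x y : inner x y = inner y x.
Proof. by rewrite hermC/= expr0 mul1r. Qed.

Lemma innerDl x y z : inner (x + y) z = inner x z + inner y z.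
Proof. by rewrite linearDl. Qed.

Lemma innerDr x y z : inner z (x + y) = inner z x + inner z y.
Proof. by rewrite linearDr. Qed.

Lemma innerNl x z : inner (- x) z = - inner x z.
Proof. by rewrite linearNl. Qed.

Lemma innerNr x z : inner z (- x) = - inner z x.
Proof. by rewrite linearNr. Qed.

Lemma innerZl a x z : inner (a *: x) z = a * inner x z.
Proof. by rewrite linearZl_LR. Qed.

Lemma innerZr a x z : inner z (a *: x) = a * inner z x.
Proof. by rewrite innerC innerZl innerC. Qed.

Definition innerE := (innerDl, innerDr, innerNl, innerNr, innerZl, innerZr).

Lemma inner_ge0 x : 0 <= inner x x.
Proof. by rewrite inner_normE sqr_ge0. Qed.

Lemma inner_eq0 x : inner x x = 0 -> x = 0.
Proof. by rewrite inner_normE => /eqP; rewrite sqrf_eq0 normr_eq0 => /eqP. Qed.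

Lemma cauchy_schwarz x y : `|inner x y| <= `|x| * `|y|.
Proof.
have [->|y0] := eqVneq y 0.
  by rewrite linear0r !normr0 mulr0.
have Y0 : 0 < inner y y by rewrite inner_normE exprn_gt0 ?normr_gt0.
rewrite -ler_sqr ?nnegrE ?mulr_ge0// exprMn -!inner_normE.
rewrite real_normK ?num_real//.
have := inner_ge0 (inner y y *: x - inner x y *: y).
rewrite !innerE (innerC y x) => h.
have {h}: 0 <= inner y y * (inner x x * inner y y - inner x y ^+ 2) by nra.
by rewrite pmulr_rge0// subr_ge0.
Qed.

End InnerProduct.

(** * The Riesz representation theorem *)

Section Riesz.
Context {R : realType} {V : hilbertType R}.

Lemma cvg_inner {T : Type} {F : set_system T} {FF : Filter F}
    (f : T -> V) (l y : V) :
  f @ F --> l -> inner (f x) y @[x --> F] --> inner l y.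
Proof.
move=> fl; apply/cvgrPdist_lt => e e0.
have y1 : 0 < `|y| + 1 by rewrite ltr_wpDl.
move/cvgrPdist_lt : fl => /(_ (e / (`|y| + 1)) (divr_gt0 e0 y1)).
apply: filterS => t; rewrite ltr_pdivlMr// => h.
have -> : inner l y - inner (f t) y = inner (l - f t) y by rewrite !innerE.
apply: le_lt_trans (cauchy_schwarz _ _) _.
by apply: le_lt_trans h; rewrite ler_wpM2l// lerDl.
Qed.

(** The representing vector minimizes J x = |x|^2 - 2 phi x. Minimizing
    sequences are Cauchy by the parallelogram identity, and a near minimizer x
    nearly satisfies the first-order condition <x, h> = phi h
    ([near_min]), with an error that vanishes in the limit. *)
Lemma riesz_representation (phi : V -> R) (B : R) :
  scalar phi -> (forall x, `|phi x| <= B * `|x|) ->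
  exists u, forall x, phi x = inner u x.
Proof.
move=> phiL phiB.
have phiD x y : phi (x + y) = phi x + phi y.
  by rewrite -[x]scale1r phiL mul1r scale1r.
have phi0 : phi 0 = 0 by move: (phiD 0 0); rewrite addr0; lra.
have phiZ a x : phi (a *: x) = a * phi x.
  by rewrite -[_ *: x]addr0 phiL phi0 addr0.
pose J x := inner x x - 2 * phi x.
have J_lb : lbound [set J x | x in [set: V]] (- B ^+ 2).
  move=> _ [x _ <-]; rewrite /J inner_normE.
  have := phiB x; rewrite ler_norml => /andP[_ h].
  have := sqr_ge0 (`|x| - B); nra.
have J_inf : has_inf [set J x | x in [set: V]].
  by split; [exists (J 0), 0 | exists (- B ^+ 2)].
pose m := inf [set J x | x in [set: V]].
have mJ x : m <= J x by apply: ge_inf; [case: J_inf|exists x].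
pose d n : R := n.+1%:R^-1.
have d0 n : 0 < d n by rewrite invr_gt0.
have /choice[v vP] n : exists x, J x < m + d n ^+ 2.
  have [_ [x _ <-] ?] := inf_adherent (exprn_gt0 2 (d0 n)) J_inf.
  by exists x.
(* Compare J x with the minimum of J on the line x + R h, which is reached at
   step - (<x, h> - phi h) / |h|^2. *)
have near_min x h e : 0 < e -> J x < m + e ^+ 2 ->
    `|inner x h - phi h| <= e * `|h|.
  move=> e0 xm.
  have [->|h0] := eqVneq h 0.
    by rewrite linear0r phi0 subrr !normr0 mulr0.
  have H0 : 0 < inner h h by rewrite inner_normE exprn_gt0 ?normr_gt0.
  rewrite -ler_sqr ?nnegrE ?mulr_ge0 ?(ltW e0)// exprMn -inner_normE.
  rewrite real_normK ?num_real//.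
  set g := inner x h - phi h.
  have := mJ (x + (- (g / inner h h)) *: h).
  have -> : J (x + (- (g / inner h h)) *: h) = J x - g ^+ 2 / inner h h.
    rewrite /J phiD phiZ !innerE (innerC h x) /g; field; exact: lt0r_neq0.
  move=> mx.
  have : g ^+ 2 / inner h h <= e ^+ 2 by lra.
  by rewrite ler_pdivrMr.
(* Parallelogram identity, evaluating J at the midpoint of v n and v p. *)
have v_near n p : `|v n - v p| ^+ 2 <= 2 * d n ^+ 2 + 2 * d p ^+ 2.
  rewrite -inner_normE.
  have := mJ (2^-1 *: (v n + v p)); have := vP n; have := vP p.
  rewrite /J phiZ phiD !innerE (innerC (v p) (v n)); lra.
have v_cvg : cvgn v.
  apply: cauchy_cvg; apply: cauchy_exP => e e0.
  have [N _ NP] : \forall n \near \oo, d n < e / 2.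
    have /cvgr0_norm_lt/(_ (e / 2)) : d @ \oo --> (0 : R).
      exact: cvg_harmonic.
    move=> /(_ (divr_gt0 e0 (ltr0n _ 2)))/=; apply: filterS => n.
    by rewrite gtr0_norm.
  exists (v N); exists N => // n /= Nn.
  rewrite -ball_normE /ball_/= -ltr_sqr ?nnegrE ?(ltW e0)//.
  apply: le_lt_trans (v_near _ _) _.
  have := NP N (leqnn N); have := NP n Nn => /=.
  have := d0 n; have := d0 N; nra.
exists (lim (v @ \oo)) => x.
apply/esym; apply: (cvg_unique _ (cvg_inner (y := x) v_cvg)) => //.
apply/cvgrPdist_lt => e e0.
have x1 : 0 < `|x| + 1 by rewrite ltr_wpDl.
have /cvgr0_norm_lt/(_ _ (divr_gt0 e0 x1)) : d @ \oo --> (0 : R).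
  exact: cvg_harmonic.
apply: filterS => n; rewrite gtr0_norm// ltr_pdivlMr// => h.
rewrite distrC; apply: le_lt_trans (near_min _ _ _ (d0 n) (vP n)) _.
by apply: le_lt_trans h; rewrite ler_wpM2l ?lerDl// ltW.
Qed.

End Riesz.

(** * Limits along ultrafilters *)

Section UltraLimits.

(** A cluster point of an ultrafilter is a limit of it: a neighbourhood whose
    preimage is not in the ultrafilter has the complement of the preimage in
    it. *)
Lemma compact_ultra_cvg {T : Type} {G : set_system T} {U : topologicalType}
    (K : set U) (f : T -> U) :
  UltraFilter G -> compact K -> (forall t, K (f t)) ->
  exists l : U, f @ G --> l.
Proof.
move=> GU cK Kf.
have [l [_ lcl]] : K `&` cluster (f @ G) !=set0.
  by apply: cK; exact: (filterE (F := G)) Kf.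
exists l => N Nl /=.
have [//|GNc] := in_ultra_setVsetC (f @^-1` N) GU.
by have [x []] := lcl (~` N) N GNc Nl.
Qed.

(** If the preimage of a neighbourhood N were not in F, the trace of F on the
    complement of that preimage would be a proper filter, and an ultrafilter
    finer than it would contradict the hypothesis. *)
Lemma cvg_ultra {T : Type} {F : set_system T} {U : topologicalType}
    (f : T -> U) (l : U) : ProperFilter F ->
  (forall G : set_system T, UltraFilter G -> F `<=` G -> f @ G --> l) ->
  f @ F --> l.
Proof.
move=> FF h N Nl; apply: contrapT => nFN.
pose S := ~` (f @^-1` N).
have SF : ProperFilter (within S F).
  apply: Build_ProperFilter_ex => A WA; apply: contrapT => A0; apply: nFN.
  apply: (@filterS _ F _ (fun t => S t -> A t)) WA => t WA.
  by apply: contrapT => /WA At; apply: A0; exists t.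
have [G [GU WG]] := ultraFilterLemma SF.
have GS : G S by apply: WG; exact: withinT.
have GN : G (f @^-1` N).
  by apply: (h G GU _ N Nl) => A FA; apply: WG;
    exact: (@cvg_within _ F _ S A FA).
by have [t []] := filter_ex (filterI GS GN).
Qed.

Context {R : realType} {V : hilbertType R}.

(** The limits of the inner products form a bounded linear functional of the
    second argument, which the Riesz theorem represents by the weak limit. *)
Lemma bounded_ultra_weak_cvg {T : Type} {G : set_system T} (w : T -> V) B :
  UltraFilter G -> (forall t, `|w t| <= B) ->
  exists l, forall y, inner (w t) y @[t --> G] --> inner l y.
Proof.
move=> GU wB.
have /choice[phi phiP] y : exists a : R, inner (w t) y @[t --> G] --> a.
  apply: (compact_ultra_cvg (K := [set` `[- (B * `|y|), B * `|y|]]) _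
    (@segment_compact R _ _)) => t.
  rewrite /= in_itv/= -ler_norml.
  by apply: le_trans (cauchy_schwarz _ _) _; rewrite ler_wpM2r.
have phiL : scalar phi.
  move=> a x y.
  apply: (cvg_unique _ (phiP _)) => //.
  rewrite (_ : (fun _ => _) = (fun t => a * inner (w t) x + inner (w t) y)).
    by apply: cvgD (phiP y); apply: cvgMl_tmp (phiP x).
  by apply/funext => t; rewrite !innerE.
have phiB x : `|phi x| <= B * `|x|.
  apply: (cvgr_to_le (cvg_norm (phiP x))); apply: nearW => t.
  by apply: le_trans (cauchy_schwarz _ _) _; rewrite ler_wpM2r.
have [l lP] := riesz_representation phiL phiB.
by exists l => y; rewrite -lP; exact: phiP.
Qed.

End UltraLimits.

(** * The Krasnosel'skii-Mann theorem *)

Definition firmly_nonexpansive {R : realType} {V : hilbertType R}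
    (T : V -> V) : Prop :=
  forall x y, inner (T x - T y) (T x - T y) <= inner (T x - T y) (x - y).

Section KrasnoselskiiMann.
Context {R : realType} {V : hilbertType R} (T : V -> V)
  (fneT : firmly_nonexpansive T).

(** With e = T x - x and d = x - p, firm nonexpansiveness at x and p reads
    |e|^2 + <e, d> <= 0, which bounds the cross term of |d + a e|^2. *)
Lemma firmly_nonexpansive_fejer p x a :
  T p = p -> 0 <= a ->
  inner (x + a *: (T x - x) - p) (x + a *: (T x - x) - p)
    + a * (2 - a) * inner (T x - x) (T x - x) <= inner (x - p) (x - p).
Proof.
move=> Tp a0; have := fneT x p; rewrite Tp.
set e := T x - x; set d := x - p.
have -> : T x - p = e + d by rewrite /e /d addrA subrK.
have -> : x + a *: e - p = d + a *: e by rewrite /d addrAC.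
clearbody e d; rewrite !innerE (innerC d e) => h.
nra.
Qed.

(** With e and f the residuals at x and y, firm nonexpansiveness at y and x
    gives |f - e|^2 + a <f - e, e> <= 0, hence
    a (|f|^2 - |e|^2) <= (a - 2) |f - e|^2. *)
Lemma relaxation_residual_le x y a : 0 <= a <= 2 ->
  y = x + a *: (T x - x) ->
  inner (T y - y) (T y - y) <= inner (T x - x) (T x - x).
Proof.
move=> /andP[a_ge0 a_le2] yE.
have [a0|a0] := eqVneq a 0; first by rewrite yE a0 scale0r addr0.
have ap : 0 < a by rewrite lt_def a0.
have := fneT y x.
have -> : T y - T x = T y - y - (T x - x) + (y - x).
  by rewrite opprB addrAC !subrKA.
have -> : y - x = a *: (T x - x) by rewrite yE addrC addKr.
set e := T x - x; set f := T y - y; clearbody e f.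
have := inner_ge0 (f - e); rewrite !innerE (innerC f e) => h2 h.
have {h} : a * (inner f f - inner e e) <= 0 by nra.
by rewrite pmulr_rle0// subr_le0.
Qed.

(** Demiclosedness of I - T: with q = T l - l and e = T (w t) - w t, firm
    nonexpansiveness at w t and l bounds |q|^2 by <w t - l, q> plus a multiple
    of |e|, and both terms tend to 0. *)
Lemma demiclosed_fixed_point {I : Type} {G : set_system I} (w : I -> V) l B :
  ProperFilter G -> (forall t, `|w t| <= B) ->
  (forall y, inner (w t) y @[t --> G] --> inner l y) ->
  `|T (w t) - w t| @[t --> G] --> (0 : R) -> T l = l.
Proof.
move=> GF wB wl e0; apply/eqP; rewrite -subr_eq0; apply/eqP.
set q := T l - l; apply: inner_eq0; apply: le_anti; rewrite inner_ge0 andbT.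
pose b t := inner (w t) q - inner l q
  + (B + `|l| + 2 * `|q|) * `|T (w t) - w t|.
have b0 : b @ G --> (0 : R).
  rewrite -(addr0 0) -{1}(subrr (inner l q)) -(mulr0 (B + `|l| + 2 * `|q|)).
  by apply: cvgD; [apply: cvgB (wl q) (cvg_cst _) | apply: cvgMl_tmp].
apply: (cvgr_to_ge b0); apply: nearW => t; rewrite /b.
have := fneT (w t) l; set e := T (w t) - w t.
have -> : T (w t) - T l = w t - l + (e - q).
  by rewrite /e /q opprB addrCA !subrKA.
have := ler_normlW (cauchy_schwarz l e).
have := ler_normlW (cauchy_schwarz e q).
have : - inner (w t) e <= B * `|e|.
  have := cauchy_schwarz (w t) e; rewrite ler_norml => /andP[h _].
  by rewrite lerNl (le_trans _ h)// lerN2 ler_wpM2r.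
move: (w t) => x; clearbody e q.
rewrite !innerE (innerC q e) (innerC q x) (innerC q l) (innerC e l).
rewrite (innerC e x).
move=> h1 h2 h3 h4; have := inner_ge0 e; nra.
Qed.

Context (lam : nat -> R) (w : nat -> V) (p : V)
  (lam02 : forall k, 0 <= lam k <= 2)
  (wS : forall k, w k.+1 = w k + lam k *: (T (w k) - w k))
  (Tp : T p = p).

Let r k := inner (T (w k) - w k) (T (w k) - w k).

Lemma km_energy n :
  inner (w n - p) (w n - p) + \sum_(0 <= k < n) lam k * (2 - lam k) * r k
    <= inner (w 0%N - p) (w 0%N - p).
Proof.
elim: n => [|n IHn]; first by rewrite big_nil addr0.
rewrite big_nat_recr//= addrCA; apply: le_trans IHn.
rewrite [leRHS]addrC lerD2l wS.
by apply: firmly_nonexpansive_fejer => //; case/andP: (lam02 n).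
Qed.

Lemma km_dist_le n :
  inner (w n.+1 - p) (w n.+1 - p) <= inner (w n - p) (w n - p).
Proof.
have /andP[l0 l2] := lam02 n.
have := firmly_nonexpansive_fejer (w n) Tp l0; rewrite -wS; apply: le_trans.
by rewrite lerDl !mulr_ge0 ?subr_ge0 ?inner_ge0.
Qed.

Lemma km_bounded n : `|w n| <= `|w 0%N - p| + `|p|.
Proof.
have h : `|w n - p| <= `|w 0%N - p|.
  rewrite -ler_sqr ?nnegrE// -!inner_normE.
  by elim: n => [//|n]; apply: le_trans; exact: km_dist_le.
rewrite -{1}(subrK p (w n)); apply: le_trans (ler_normD _ _) _.
by rewrite lerD2r.
Qed.

(** The residuals are nonincreasing, so by [km_energy] the n-th one times the
    n-th partial sum of lam k * (2 - lam k) stays bounded, while these partial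
    sums tend to infinity. *)
Lemma km_residual_cvg0 :
  (\sum_(0 <= k <oo) (lam k * (2 - lam k))%:E = +oo)%E ->
  `|T (w n) - w n| @[n --> \oo] --> (0 : R).
Proof.
move=> lamy.
have l0 k : 0 <= lam k * (2 - lam k).
  by have /andP[? ?] := lam02 k; rewrite mulr_ge0 ?subr_ge0.
have rS k : r k.+1 <= r k by apply: relaxation_residual_le (lam02 k) (wS k).
have r_le m n : (m <= n)%N -> r n <= r m.
  elim: n => [|n IHn]; first by rewrite leqn0 => /eqP->.
  by rewrite leq_eqVlt => /predU1P[->//|/IHn]; exact: le_trans.
set D := inner (w 0%N - p) (w 0%N - p).
have rD n : (\sum_(0 <= k < n) lam k * (2 - lam k)) * r n <= D.
  apply: le_trans (km_energy n).
  apply: le_trans (ler_wpDl (inner_ge0 _) (lexx _)).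
  rewrite mulr_suml !big_mkord; apply: ler_sum => k _.
  by rewrite ler_wpM2l// r_le// ltnW.
apply/cvgr0Pnorm_lt => e e0.
have Se : (fun n => \sum_(0 <= k < n) (lam k * (2 - lam k))%:E)%E
    @ \oo --> (+oo)%E.
  by rewrite -lamy; apply: is_cvg_nneseries => k _ _; rewrite lee_fin.
move/cvgeyPge : Se => /(_ ((D + 1) / e ^+ 2)) [N _ /(_ N (leqnn N))]/=.
rewrite sumEFin lee_fin => SN.
exists N => // n /= Nn; rewrite normr_id -ltr_sqr ?nnegrE ?(ltW e0)//.
rewrite -inner_normE; apply: le_lt_trans (r_le _ _ Nn) _.
have e2 : 0 < e ^+ 2 by rewrite exprn_gt0.
rewrite ltNge; apply/negP => er.
move: SN; rewrite ler_pdivrMr// leNgt => /negP; apply.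
apply: (@le_lt_trans _ _ D); last by rewrite ltrDl.
apply: le_trans (rD N); rewrite ler_wpM2l//.
by rewrite sumr_ge0.
Qed.

End KrasnoselskiiMann.

Theorem krasnoselskii_mann (R : realType) (V : hilbertType R) (T : V -> V)
    (lam : nat -> R) (w : nat -> V) :
  firmly_nonexpansive T -> (exists p, T p = p) ->
  (forall k, 0 <= lam k <= 2) ->
  (\sum_(0 <= k <oo) (lam k * (2 - lam k))%:E = +oo)%E ->
  (forall k, w k.+1 = w k + lam k *: (T (w k) - w k)) ->
  exists2 l, weak_cvg w l & T l = l.
Proof.
move=> fneT [p Tp] lam02 lamy wS.
have wB := km_bounded fneT lam02 wS Tp.
have e0 := km_residual_cvg0 fneT lam02 wS Tp lamy.
have ulim (G : set_system nat) : UltraFilter G -> \oo `<=` G ->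
    exists2 l, T l = l & forall y, inner (w t) y @[t --> G] --> inner l y.
  move=> GU Goo; have [l wl] := bounded_ultra_weak_cvg GU wB; exists l => //.
  apply: (demiclosed_fixed_point fneT _ wB wl).
  by move=> N /e0; exact: Goo.
(* Opial's argument: 2 <w n, x - y> is, up to a constant, the squared distance
   from w n to y minus that to x, and both converge. *)
have fix_cvg x y : T x = x -> T y = y -> cvgn (fun n => inner (w n) (x - y)).
  have dist_cvg z : T z = z -> cvgn (fun n => inner (w n - z) (w n - z)).
    move=> Tz; apply: nonincreasing_is_cvgn.
      by apply/nonincreasing_seqP => n; exact: (km_dist_le fneT lam02 wS Tz).
    by exists 0 => _ [n _ <-]; exact: inner_ge0.
  move=> /dist_cvg cx /dist_cvg cy.
  rewrite (_ : (fun _ => _) = (fun n => 2^-1 * (inner (w n - y) (w n - y)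
    - inner (w n - x) (w n - x) + (inner x x - inner y y)))).
    apply: is_cvgMl_tmp; apply: is_cvgD; last exact: is_cvg_cst.
    exact: is_cvgB.
  apply/funext => n; rewrite !innerE (innerC y (w n)) (innerC x (w n)); lra.
have [G0 [G0U ooG0]] := ultraFilterLemma eventually_filter.
have [l Tl wl] := ulim _ G0U ooG0.
exists l => // y; apply: cvg_ultra => G GU ooG.
have [l' Tl' wl'] := ulim _ GU ooG.
suff -> : l = l' by exact: wl'.
apply/eqP; rewrite -subr_eq0; apply/eqP/inner_eq0.
rewrite innerDl innerNl; apply/eqP; rewrite subr_eq0; apply/eqP.
have /cvg_ex[c cP] := fix_cvg _ _ Tl Tl'.
transitivity c.
  by apply: (cvg_unique _ (wl _)) => // N /cP; exact: ooG0.
by apply: (cvg_unique _ _ (wl' _)) => // N /cP; exact: ooG.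
Qed.

(** * Adjoints of bounded operators *)

Section Adjoint.
Context {R : realType} {U V : hilbertType R}.

Lemma adjoint_unique (L : U -> V) (u : U) (v : V) :
  (forall x, inner (L x) v = inner x u) -> adjoint L v = u.
Proof.
move=> uP; apply: xget_unique => // u' u'P.
apply/eqP; rewrite -subr_eq0; apply/eqP/inner_eq0.
by rewrite innerDr innerNr -uP -u'P subrr.
Qed.

(** Boundedness of L makes x |-> <L x, v> a functional that the Riesz theorem
    represents, so that the default value in [adjoint] is never reached. *)
Lemma inner_adjoint (L : {linear U -> V}) x v :
  bounded_fun_norm L -> inner (L x) v = inner x (adjoint L v).
Proof.
move=> Lb; move: x.
suff [u uP] : exists u : U, forall x, inner (L x) v = inner x u.
  by move=> x; rewrite (adjoint_unique uP).
have /bounded_funP/linear_boundedP/pinfty_ex_gt0[B _ LB] := Lb.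
have [|x|u uP] := @riesz_representation R U (fun x => inner (L x) v) (B * `|v|).
- by move=> a x y; rewrite linearP innerDl innerZl.
- apply: le_trans (cauchy_schwarz _ _) _.
  by rewrite mulrAC ler_wpM2r.
- by exists u => x; rewrite uP innerC.
Qed.

Lemma adjoint_linear (L : {linear U -> V}) : bounded_fun_norm L ->
  linear (adjoint L).
Proof.
move=> Lb a v v'; apply: adjoint_unique => x.
by rewrite !innerDr !innerZr !inner_adjoint.
Qed.

Lemma adjointB (L : {linear U -> V}) : bounded_fun_norm L ->
  {morph adjoint L : v v' / v - v'}.
Proof.
move=> Lb v v'; apply: adjoint_unique => x.
by rewrite !innerDr !innerNr !inner_adjoint.
Qed.

End Adjoint.

(** * Resolvents of multivalued operators *)

Section Resolvents.
Context {X Z : Type} {Y : zmodType}.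

Lemma op_valP (B : X -> set Y) x : is_totalfun B -> B x (op_val B x).
Proof. by move=> Bt; apply: fun_of_relP; have [] := Bt x. Qed.

Lemma op_val_unique (B : X -> set Y) x y :
  is_totalfun B -> B x y -> op_val B x = y.
Proof. by move=> Bt; apply: fun_of_rel_uniq; have [] := Bt x. Qed.

Lemma op_comp_inv_addE (M : Z -> Y) (A : Z -> set Y) (f : X -> Y) x y :
  op_comp (op_inv (op_add (op_fun M) A)) (op_fun f) x y = A y (f x - M y).
Proof.
apply/propext; split.
  by move=> [_ -> [_ -> [b Ab <-]]]; rewrite addrC addKr.
by move=> Ab; exists (f x) => //; exists (M y) => //; exists (f x - M y) => //;
  rewrite addrC subrK.
Qed.

Lemma op_resolventE (B : Y -> set Y) x y :
  op_inv (op_add (op_fun idfun) B) x y <-> B y (x - y).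
Proof.
split; first by move=> [_ -> [b Bb <-]]; rewrite addrC addKr.
by move=> Bb; exists y => //; exists (x - y) => //; rewrite addrC subrK.
Qed.

End Resolvents.

Lemma monotone_resolvent_firmly_nonexpansive (R : realType)
    (D : hilbertType R) (B : D -> set D) :
  monotone_by idfun B -> is_totalfun (op_inv (op_add (op_fun idfun) B)) ->
  firmly_nonexpansive (op_val (op_inv (op_add (op_fun idfun) B))).
Proof.
move=> mono Jtot x y.
have /op_resolventE Bx := op_valP x Jtot.
have /op_resolventE By := op_valP y Jtot.
have := mono _ _ _ _ Bx By; rewrite /inner_by/=.
set p := op_val _ x; set q := op_val _ y.
have -> : x - p - (y - q) = (x - y) - (p - q).
  by rewrite !opprB addrACA (addrC (- p)) addrACA.
by rewrite innerDl innerNl subr_ge0 (innerC (x - y)).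
Qed.

Section ParallelComposition.
Context {R : realType} {H D : hilbertType R}.

Lemma parallel_compE (C : D -> H) (A : H -> set H) z b :
  parallel_comp C A z b <-> exists2 y, A y (C b) & z = adjoint C y.
Proof.
split; first by move=> [y [_ -> Ay] ->]; exists y.
by move=> [y Ay ->]; exists y => //; exists (C b).
Qed.

(** Points of the graph have the form (C^* y, C^* v) with M v in A y, and
    <C^* (v - v'), C^* (y - y')> = <M (v - v'), y - y'>. *)
Lemma parallel_comp_monotone (C : {linear D -> H}) (M : H -> H)
    (A : H -> set H) :
  bounded_fun_norm C -> range (adjoint C) = [set: D] -> M = C \o adjoint C ->
  monotone_by M (precond_op M A) -> monotone_by idfun (parallel_comp C A).
Proof.
move=> bC onto ME mono z b z' b' /parallel_compE[y Ay ->].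
move=> /parallel_compE[y' Ay' ->].
have onto_ex d : exists v, adjoint C v = d.
  by have [v _ <-] : range (adjoint C) d; [rewrite onto | exists v].
have [[v vb] [v' vb']] := (onto_ex b, onto_ex b').
have := mono y v y' v'; rewrite /precond_op /inner_by ME/= vb vb'.
by move=> /(_ Ay Ay'); rewrite inner_adjoint// !(adjointB bC) vb vb'.
Qed.

End ParallelComposition.

(** * Reduction to the resolvent of the parallel composition *)

Theorem theorem2p14 (R : realType) (H D : hilbertType R)
  (A : H -> set H) (M : {linear H -> H}) (C : {linear D -> H})
  (zerA : zer A !=set0)
  (admM : admissible_preconditioner A M)
  (clM : closed (range M : set H))
  (monoMA : monotone_by M (precond_op M A))
  (bndC : bounded_fun_norm C)
  (injC : injective C)
  (ontoC : range (adjoint C) = [set: D])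
  (facM : (M : H -> H) = C \o adjoint C)
  (lam : nat -> R)
  (lam02 : forall k, 0 <= lam k <= 2)
  (lamdiv : (\sum_(0 <= k <oo) (lam k * (2 - lam k))%:E = +oo)%E)
  (u0 : H) (u : nat -> H)
  (u_0 : u 0%N = u0)
  (u_S : forall k,
    u k.+1 = u k + lam k *: (op_val (precond_resolvent M A) (u k) - u k))
  (w : nat -> D)
  (w_0 : w 0%N = adjoint C u0)
  (w_S : forall k,
    w k.+1 = w k + lam k *: (op_val (parallel_resolvent C A) (w k) - w k)) :
  [/\ is_totalfun (parallel_resolvent C A),
      forall k, w k = adjoint C (u k) &
      exists wstar : D, weak_cvg w wstar /\
        exists ustar : H,
          op_comp (op_inv (op_add (op_fun M) A)) (op_fun C) wstar
            = [set ustar]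
          /\ op_val (precond_resolvent M A) ustar = ustar].
Proof.
have [_ _ _ Ttot] := admM.
have CM v : C (adjoint C v) = M v by rewrite facM.
have onto d : exists v, adjoint C v = d.
  by have [v _ <-] : range (adjoint C) d; [rewrite ontoC | exists v].
have TE v y : precond_resolvent M A v y = A y (M v - M y).
  exact: op_comp_inv_addE.
have TtE d z : parallel_resolvent C A d z <->
    exists2 y, A y (C d - M y) & z = adjoint C y.
  rewrite /parallel_resolvent op_resolventE parallel_compE.
  by split=> -[y Ay zE]; exists y => //; move: Ay; rewrite zE linearB/= CM.
have Tttot : is_totalfun (parallel_resolvent C A).
  move=> d; have [v <-] := onto d.
  have [[y Ty] Tuniq] := Ttot v; split.
    by exists (adjoint C y); apply/TtE; exists y; rewrite ?CM -?TE.
  move=> z z' /TtE[y1 Ay1 ->] /TtE[y2 Ay2 ->].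
  by rewrite (Tuniq y1 y2)// TE -(CM v).
have TtC v : op_val (parallel_resolvent C A) (adjoint C v) =
    adjoint C (op_val (precond_resolvent M A) v).
  apply: op_val_unique => //; apply/TtE.
  exists (op_val (precond_resolvent M A) v) => //.
  by rewrite CM -TE; exact: op_valP.
split => //.
  elim=> [|k IHk]; first by rewrite w_0 u_0.
  by rewrite w_S u_S IHk TtC [in RHS]addrC (adjoint_linear bndC)
    (adjointB bndC) addrC.
have Ttfne : firmly_nonexpansive (op_val (parallel_resolvent C A)).
  apply: monotone_resolvent_firmly_nonexpansive => //.
  exact: (parallel_comp_monotone bndC ontoC facM monoMA).
have Ttfix : exists p, op_val (parallel_resolvent C A) p = p.
  have [y Ay] := zerA; exists (adjoint C y); apply: op_val_unique => //.
  by apply/TtE; exists y; rewrite // CM subrr.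
have [l wl Ttl] := krasnoselskii_mann Ttfne Ttfix lam02 lamdiv w_S.
exists l; split=> //; have [v vl] := onto l.
set y := op_val (precond_resolvent M A) v.
have Cy : adjoint C y = l by rewrite -TtC vl.
have Tv : precond_resolvent M A v = [set y].
  apply/seteqP; split=> [x Tx|_ ->]; last exact: op_valP.
  by have [_ Tuniq] := Ttot v; apply: Tuniq => //; exact: op_valP.
exists y; split.
  by rewrite -Tv; apply/funext => x; rewrite op_comp_inv_addE TE -vl CM.
apply: op_val_unique => //.
(* T only depends on its argument through M, and M v = C l = M y. *)
have Mvy : M v = M y by rewrite -!CM Cy vl.
by rewrite TE -{1}Mvy -TE Tv.
Qed.
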